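(* Let $n\geq 1$ and let $\alpha$ be a positive $(2,2)$-form in $\mathbb C^n$. Then the $(4,4)$-form $\alpha^2=\alpha\wedge\alpha$ is also positive.
   Context: Forms are constant-coefficient forms on $\mathbb C^n$, i.e. elements of the exterior algebra generated by $(\mathbb C^n)^\ast$ and its conjugate. A $(p,p)$-form $\alpha$ in $\mathbb C^n$ is called positive (written $\alpha\geq 0$) if for all $(1,0)$-forms $\gamma_1,\dots,\gamma_{n-p}\in(\mathbb C^n)^\ast$ one has $\alpha\wedge i\gamma_1\wedge\bar\gamma_1\wedge\dots\wedge i\gamma_{n-p}\wedge\bar\gamma_{n-p}\geq 0$, meaning this $(n,n)$-form is a nonnegative real multiple of the standard volume form $idz_1\wedge d\bar z_1\wedge\dots\wedge idz_n\wedge d\bar z_n$. (A $(p,p)$-form with $p>n$ is zero and counts as positive.) *)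

(* Defs.v *)
(* constant-coefficient forms on C^n, with C := R[i], R : realType *)
From HB Require Import structures.
From mathcomp Require Import all_boot all_order all_algebra.
From mathcomp Require Import complex.
From mathcomp Require Import reals.
Set Implicit Arguments. Unset Strict Implicit. Unset Printing Implicit Defensive.
Import Order.TTheory GRing.Theory Num.Theory.
Local Open Scope ring_scope.
Local Open Scope complex_scope.

Section Forms.
Variables (R : realType) (n : nat).
Local Notation C := R[i].

(* Generators of the exterior algebra: inl k = dz_k, inr k = dzbar_k. *)
Definition gen := ('I_n + 'I_n)%type.

(* Fixed total ordering of the generators: dz_0 < ... < dz_{n-1} < dzbar_0 < ... *)
Definition gidx (x : gen) : nat :=
  match x with inl k => nat_of_ord k | inr k => (n + k)%N end.

(* A cform is given by its coefficients on the basis e_S = wedge of the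
   generators in S, taken in increasing gidx order. *)
Definition cform := {ffun {set gen} -> C}.

(* sign of e_A /\ e_B = sgn A B * e_(A :|: B) for disjoint A, B *)
Definition wsign (A B : {set gen}) : C :=
  (-1) ^+ #|[set p : gen * gen | (p.1 \in A) && (p.2 \in B) && (gidx p.2 < gidx p.1)%N]|.

Definition wedge (a b : cform) : cform :=
  [ffun S => \sum_(A : {set gen}) \sum_(B : {set gen} |
                 (A :|: B == S) && [disjoint A & B]) wsign A B * a A * b B].

Definition cform1 : cform := [ffun S => (S == set0)%:R].

Definition wedge_seq (s : seq cform) : cform := foldr wedge cform1 s.

Definition form10 (c : 'I_n -> C) : cform :=
  [ffun S => \sum_(k < n) (S == [set inl k])%:R * c k].
Definition conj10 (c : 'I_n -> C) : cform :=
  [ffun S => \sum_(k < n) (S == [set inr k])%:R * (c k)^*].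

Definition igg (c : 'I_n -> C) : cform := (Complex 0 1) *: wedge (form10 c) (conj10 c).

Definition dz (k : 'I_n) : 'I_n -> C := fun j => (j == k)%:R.

Definition vol : cform := wedge_seq [seq igg (dz k) | k <- enum 'I_n].

Definition is_bideg (p q : nat) (a : cform) : Prop :=
  forall S : {set gen}, a S != 0 ->
    #|[set k : 'I_n | inl k \in S]| = p /\ #|[set k : 'I_n | inr k \in S]| = q.

Definition positive_form (p : nat) (a : cform) : Prop :=
  is_bideg p p a /\
  forall g : 'I_(n - p) -> 'I_n -> C,
    exists c : R, 0 <= c /\
      wedge a (wedge_seq [seq igg (g j) | j <- enum 'I_(n - p)]) = (c%:C) *: vol.

End Forms.

(* Main.v *)
Require Import Defs.
From HB Require Import structures.
From mathcomp Require Import all_boot all_order all_algebra.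
From mathcomp Require Import complex.
From mathcomp Require Import reals.
From mathcomp Require Import ring.
Set Implicit Arguments. Unset Strict Implicit. Unset Printing Implicit Defensive.
Import Order.TTheory GRing.Theory Num.Theory.
Local Open Scope ring_scope.
Local Open Scope sesquilinear_scope.

(* Let [T] be the product of the forms [i g_j /\ conj g_j], [j < n - 4]. If the [g_j] are
   dependent then [T = 0]; otherwise four covectors [e_0, ..., e_3] complete them to a
   basis, and modulo the [g_j] a (2,2)-form becomes a matrix [M] indexed by the six pairs
   [e_s /\ e_t]. Then [alpha^2 /\ T] is [tr (M E M^T E)] times a nonnegative form, where
   [E] is the Gram matrix of the wedge pairing on the six pairs, and positivity of [alpha]
   says that the Hermitian form [E M E] is nonnegative on decomposable 2-vectors, that is
   on the isotropic vectors of [E]. The trace is nonnegative for every such [M]: this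
   follows from the spectral theorem. *)

(** * A trace inequality for forms nonnegative on isotropic vectors *)

Section IsotropicTrace.
Variables (C : numClosedFieldType) (N : nat).
Implicit Types (A E M W : 'M[C]_N) (u w : 'rV[C]_N).

Lemma trmxC_mul m1 m2 m3 (M1 : 'M[C]_(m1, m2)) (M2 : 'M[C]_(m2, m3)) :
  (M1 *m M2)^t* = M2^t* *m M1^t*.
Proof. by rewrite trmx_mul map_mxM. Qed.

(** For Hermitian [W] the trace is the sum of [|W k l|^2] over all entries; only the diagonal ones
    are kept. *)
Lemma hermitian_trace_sqr_ge W : W^t* = W ->
  \sum_k W k k * (W k k)^* <= \tr (W *m W).
Proof.
move=> WH; rewrite /mxtrace; apply: ler_sum => k _.
rewrite mxE (bigD1 k) //=; have WE l : W l k = (W k l)^*.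
  by rewrite -[in LHS]WH !mxE.
rewrite -WE lerDl; apply: sumr_ge0 => l _.
by rewrite WE mul_conjC_ge0.
Qed.

(* Writing [B = E A^T E], [X = A + B], [Z = A - B], the claim is
   [tr Z^2 <= tr X^2]. An eigenvector of [Z] with nonzero eigenvalue is
   isotropic, so evaluating [A] and [B] on it bounds the eigenvalue by the
   corresponding diagonal entry of [X]. *)
Lemma isotropic_nonneg_trace A E :
    A^t* = A -> E^T = E -> E^t* = E -> E *m E = 1%:M ->
    (forall w, w *m E *m w^T = 0 -> 0 <= (w *m A *m w^t*) 0 0) ->
  0 <= \tr (A *m E *m A^T *m E).
Proof.
move=> AH ET EH EE Apos.
pose B := E *m A^T *m E; pose X := A + B; pose Z := A - B.
have EC : E ^ Num.conj = E by rewrite -[in LHS]ET.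
have BH : B^t* = B.
  by rewrite /B !trmxC_mul EH mulmxA trmxK -[in RHS]AH map_trmx trmxK.
have XH : X^t* = X by rewrite /X linearD map_mxD AH BH.
have ZH : Z^t* = Z by rewrite /Z linearB map_mxB AH BH.
(* [Z] is skew for the bilinear form [E], which makes eigenvectors with nonzero eigenvalue
   isotropic. *)
have EZ : E *m Z *m E = - Z^T.
  rewrite /Z /B [X in _ = - X]linearB /= !trmx_mul trmxK ET mulmxBr mulmxBl !mulmxA EE mul1mx.
  by rewrite -[_ *m E *m E]mulmxA EE mulmx1 opprB.
(* As [X + Z = 2 A] and [X - Z = 2 B], this is a difference of squares, valid under the trace by
   cyclicity. *)
have trE : 4 * \tr (A *m E *m A^T *m E) = \tr (X *m X) - \tr (Z *m Z).
  rewrite -!(mulmxA A) -/B /X /Z !(mulmxDl, mulmxDr, mulNmx, mulmxN, opprK).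
  rewrite !(mxtraceD, raddfN) /= (mxtrace_mulC B A); ring.
have Znormal : Z \is normalmx by apply/normalmxP; rewrite ZH.
have /orthomx_spectralP := Znormal.
set U := spectralmx Z; set D := spectral_diag Z => ZE.
have Uun : U \is unitarymx := spectral_unitarymx Z.
have UUs : U *m U^t* = 1%:M by apply/unitarymxP.
have UsU : U^t* *m U = 1%:M by apply: mulmx1C.
rewrite invmx_unitary // in ZE.
have UZ : U *m Z = diag_mx D *m U by rewrite ZE !mulmxA UUs mul1mx.
pose W := U *m X *m U^t*.
have WH : W^t* = W by rewrite /W !trmxC_mul XH trmxCK mulmxA.
have trX : \tr (X *m X) = \tr (W *m W).
  rewrite /W -!mulmxA (mulmxA (U^t*)) UsU mul1mx [RHS]mxtrace_mulC !mulmxA.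
  by rewrite -!mulmxA UsU mulmx1.
have trZ : \tr (Z *m Z) = \sum_k D 0 k * D 0 k.
  transitivity (\tr (diag_mx D *m diag_mx D)).
    rewrite ZE -!mulmxA (mulmxA U) UUs mul1mx [LHS]mxtrace_mulC !mulmxA.
    by rewrite -!mulmxA UUs mulmx1.
  rewrite /mxtrace; apply: eq_bigr => k _; rewrite mul_diag_mx !mxE eqxx.
  by rewrite mulr1n.
(* In an eigenbasis of [Z], [tr Z^2] is the sum of the squared eigenvalues and [tr X^2] dominates
   the squared diagonal of [W], so each eigenvalue can be treated alone. *)
suff DW k : D 0 k * D 0 k <= W k k * (W k k)^*.
  rewrite -(@pmulr_rge0 _ 4) ?ltr0n // trE trX trZ subr_ge0.
  by apply: le_trans (hermitian_trace_sqr_ge WH); apply: ler_sum.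
have [->|Dk0] := eqVneq (D 0 k) 0; first by rewrite mul0r mul_conjC_ge0.
pose u := row k U.
have uZ : u *m Z = D 0 k *: u.
  rewrite /u -row_mul UZ; apply/rowP => j; rewrite !mxE (bigD1 k) //= big1.
    by rewrite !mxE eqxx mulr1n addr0.
  by move=> l lk; rewrite !mxE eq_sym (negPf lk) mulr0n mul0r.
(* Carrying [Z] across [E] changes the sign by [EZ], yet on either side it acts as the same
   eigenvalue. *)
have uiso : u *m E *m u^T = 0.
  have E1 : D 0 k *: (u *m E *m u^T) = - (D 0 k *: (u *m E *m u^T)).
    rewrite [LHS]scalemxAl [X in X *m _ = _]scalemxAl -uZ -[u *m Z]mulmx1 -{1}EE !mulmxA.
    have -> : u *m Z *m E *m E *m E = u *m E *m (E *m Z *m E).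
      rewrite -!mulmxA (mulmxA E E) EE mul1mx; congr (_ *m _).
      by rewrite !mulmxA EE mul1mx.
    by rewrite EZ mulmxN mulNmx -!mulmxA -trmx_mul uZ linearZ /= -!scalemxAr.
  apply/eqP; move/eqP: E1; rewrite -addr_eq0 -mulr2n -scaler_nat scaler_eq0.
  by rewrite pnatr_eq0 /= scaler_eq0 (negPf Dk0).
have uu : u *m u^t* = 1%:M.
  have /row_unitarymxP/(_ k k) := Uun; rewrite dotmxE eqxx => uu1.
  by apply/matrixP=> i j; rewrite !ord1 uu1 mxE.
have WX : W k k = (u *m X *m u^t*) 0 0.
  rewrite /u -row_mul mxE [RHS]mxE; apply: eq_bigr => l _.
  by rewrite !mxE.
have XZ1 : W k k + D 0 k = 2 * (u *m A *m u^t*) 0 0.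
  have -> : D 0 k = (u *m Z *m u^t*) 0 0.
    by rewrite uZ -scalemxAl uu !mxE mulr1.
  rewrite WX /X /Z !(mulmxDr, mulmxDl, mulmxN, mulNmx) !mxE; ring.
have XZ2 : W k k - D 0 k = 2 * (u *m B *m u^t*) 0 0.
  have -> : D 0 k = (u *m Z *m u^t*) 0 0.
    by rewrite uZ -scalemxAl uu !mxE mulr1.
  rewrite WX /X /Z !(mulmxDr, mulmxDl, mulmxN, mulNmx) !mxE; ring.
have P1 : 0 <= W k k + D 0 k by rewrite XZ1 mulr_ge0 ?ler0n ?Apos.
have P2 : 0 <= W k k - D 0 k.
  rewrite XZ2 mulr_ge0 ?ler0n //.
  (* Transposing the scalar turns the value of [B] at [u] into the value of [A] at [s], which is
     isotropic because [E] is real with square 1. *)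
  pose s := map_mx Num.conj u *m E.
  have -> : (u *m B *m u^t*) 0 0 = (s *m A *m s^t*) 0 0.
    have -> : s *m A *m s^t* = (u *m B *m u^t*)^T.
      have uC : (map_mx Num.conj u)^t* = u^T.
        by apply/matrixP=> i j; rewrite !mxE conjCK.
      rewrite /s trmxC_mul EH uC.
      by rewrite /B !trmx_mul ET trmxK -map_trmx trmxK !mulmxA.
    by rewrite [RHS]mxE.
  apply: Apos; rewrite /s trmx_mul ET.
  rewrite -(mulmxA (map_mx Num.conj u)) EE mulmx1.
  have -> : map_mx Num.conj u *m (E *m (map_mx Num.conj u)^T) =
      map_mx Num.conj (u *m E *m u^T).
    by rewrite !map_mxM EC -map_trmx mulmxA.
  by rewrite uiso map_mx0.
have Wr : (W k k)^* = W k k.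
  by rewrite -[in RHS]WH !mxE.
by rewrite Wr -subr_ge0 -!expr2 subr_sqr mulr_ge0.
Qed.

End IsotropicTrace.

(** * Plucker coordinates on two-vectors in dimension four *)

Section Plucker.
Variable C : numClosedFieldType.
Implicit Types (a b c d : nat -> C) (w : 'rV[C]_6).

(* Coordinates of [a /\ b] on the pairs 01, 02, 03, 12, 13, 23, in this order;
   complementary pairs are [J] and [5 - J]. *)
Definition plucker a b : 'rV[C]_6 :=
  \row_J [:: a 0%N * b 1%N - a 1%N * b 0%N; a 0%N * b 2%N - a 2%N * b 0%N;
             a 0%N * b 3%N - a 3%N * b 0%N; a 1%N * b 2%N - a 2%N * b 1%N;
             a 1%N * b 3%N - a 3%N * b 1%N; a 2%N * b 3%N - a 3%N * b 2%N]`_J.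

(** Sign of the permutation of 0, 1, 2, 3 that lists pair [J] and then its complement. *)
Definition klein_sign (J : nat) : C := [:: 1; -1; 1; 1; -1; 1]`_J.

Definition klein : 'M[C]_6 :=
  \matrix_(J, K) (klein_sign J *+ (J + K == 5)%N).

Lemma row6E w : exists x : seq C, w = \row_J [:: x`_0; x`_1; x`_2; x`_3; x`_4; x`_5]`_J.
Proof.
exists [seq w 0 J | J <- enum 'I_6]; apply/rowP => J.
have nE k (kl : (k < 6)%N) : [seq w 0 J | J <- enum 'I_6]`_k = w 0 (Ordinal kl).
  rewrite (nth_map (Ordinal kl)) ?size_enum_ord //; congr (w _ _).
  by apply: val_inj; rewrite /= nth_enum_ord.
case: J => k kl; rewrite mxE -nE.
by move: k kl => -[|[|[|[|[|[|//]]]]]].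
Qed.

(** The value is twice the Pfaffian of the antisymmetric 4 by 4 matrix whose upper entries are those
    of [w]. *)
Lemma klein_form w (x := fun k => w 0 (inord k)) :
  (w *m klein *m w^T) 0 0 = 2 * (x 0%N * x 5%N - x 1%N * x 4%N + x 2%N * x 3%N).
Proof.
rewrite /x {x}; have [x ->] := row6E w.
rewrite !mxE !big_ord_recl !big_ord0 /= !mxE !big_ord_recl !big_ord0 /=.
rewrite !mxE /= !inordK // /klein_sign /=; ring.
Qed.

(** An antisymmetric 4 by 4 matrix with zero Pfaffian has rank at most two, so the corresponding
    2-vector is decomposable. *)
Lemma isotropic_plucker w :
  w *m klein *m w^T = 0 -> exists a, exists b, w = plucker a b.
Proof.
move=> wK; have := klein_form w; rewrite /= wK mxE.
have [x ->] := row6E w; rewrite !mxE !inordK //= => /esym/eqP.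
rewrite mulf_eq0 pnatr_eq0 /= => /eqP pf.
(* If the entry (p, q) of the antisymmetric matrix of [w] is nonzero, its rows [p] and
   [q] span the plane of [w]. *)
pose r (y0 y1 y2 y3 : C) (k : nat) := [:: y0; y1; y2; y3]`_k.
pose r0 := r 0 x`_0 x`_1 x`_2.
pose r1 := r (- x`_0) 0 x`_3 x`_4.
pose r2 := r (- x`_1) (- x`_3) 0 x`_5.
pose r3 := r (- x`_2) (- x`_4) (- x`_5) 0.
(* The two rows have Plucker vector [w] times the pivot entry; the inverse of the pivot is absorbed
   into the first row. *)
have scale y s t : y != 0 ->
    y *: (\row_J [:: x`_0; x`_1; x`_2; x`_3; x`_4; x`_5]`_J : 'rV_6) = plucker s t ->
    exists a b, \row_J [:: x`_0; x`_1; x`_2; x`_3; x`_4; x`_5]`_J = plucker a b.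
  move=> y0 E; exists (fun k => y^-1 * s k), t.
  have -> : plucker (fun k => y^-1 * s k) t = y^-1 *: plucker s t.
    by apply/rowP=> -[[|[|[|[|[|[|//]]]]]] ?]; rewrite !mxE /=; ring.
  by rewrite -E scalerA mulVf // scale1r.
have [z0|z0] := eqVneq x`_0 0; last first.
  apply: (scale _ r0 r1 z0).
  apply/rowP=> -[[|[|[|[|[|[|//]]]]]] ?]; rewrite !mxE /r0 /r1 /r2 /r3 /r /=; try ring.
  (* Five coordinates agree identically; the one complementary to the pivot differs by the Pfaffian,
     up to sign. *)
  by apply/subr0_eq; rewrite -[RHS]pf; ring.
have [z1|z1] := eqVneq x`_1 0; last first.
  apply: (scale _ r0 r2 z1).
  apply/rowP=> -[[|[|[|[|[|[|//]]]]]] ?]; rewrite !mxE /r0 /r1 /r2 /r3 /r /=; try ring.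
  by apply/subr0_eq; rewrite -[RHS]oppr0 -[X in _ = - X]pf; ring.
have [z2|z2] := eqVneq x`_2 0; last first.
  apply: (scale _ r0 r3 z2).
  apply/rowP=> -[[|[|[|[|[|[|//]]]]]] ?]; rewrite !mxE /r0 /r1 /r2 /r3 /r /=; try ring.
  by apply/subr0_eq; rewrite -[RHS]pf; ring.
have [z3|z3] := eqVneq x`_3 0; last first.
  apply: (scale _ r1 r2 z3).
  apply/rowP=> -[[|[|[|[|[|[|//]]]]]] ?]; rewrite !mxE /r0 /r1 /r2 /r3 /r /=; try ring.
  by apply/subr0_eq; rewrite -[RHS]pf; ring.
have [z4|z4] := eqVneq x`_4 0; last first.
  apply: (scale _ r1 r3 z4).
  apply/rowP=> -[[|[|[|[|[|[|//]]]]]] ?]; rewrite !mxE /r0 /r1 /r2 /r3 /r /=; try ring.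
  by apply/subr0_eq; rewrite -[RHS]oppr0 -[X in _ = - X]pf; ring.
(* Only the last coordinate is left, that of [e_2 /\ e_3]. *)
exists (r 0 0 1 0), (r 0 0 0 x`_5); rewrite z0 z1 z2 z3 z4.
by apply/rowP=> -[[|[|[|[|[|[|//]]]]]] ?]; rewrite !mxE /r /=; ring.
Qed.

Lemma klein_tr : klein^T = klein.
Proof.
by apply/matrixP=> -[[|[|[|[|[|[|//]]]]]] ?] -[[|[|[|[|[|[|//]]]]]] ?]; rewrite !mxE.
Qed.

Lemma klein_trC : klein^t* = klein.
Proof.
rewrite klein_tr; apply/matrixP=> J K; rewrite !mxE rmorphMn /=; congr (_ *+ _).
by case: J => -[|[|[|[|[|[|//]]]]]] ?; rewrite /klein_sign /= ?rmorphN rmorph1.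
Qed.

Lemma klein_sqr : klein *m klein = 1%:M.
Proof.
apply/matrixP=> J K; rewrite !mxE !big_ord_recl big_ord0 !mxE.
by move: J K => -[[|[|[|[|[|[|//]]]]]] ?] -[[|[|[|[|[|[|//]]]]]] ?];
  rewrite /klein_sign /=; ring.
Qed.

(** Testing [s] on [a + c] and on [a + i c] gives two independent linear relations between [s a c]
    and [s c a]. *)
Lemma polarization (s : (nat -> C) -> (nat -> C) -> C) :
    (forall a a' c, s (fun k => a k + a' k) c = s a c + s a' c) ->
    (forall a c c', s a (fun k => c k + c' k) = s a c + s a c') ->
    (forall x a c, s (fun k => x * a k) c = x * s a c) ->
    (forall x a c, s a (fun k => x * c k) = x^* * s a c) ->
  (forall a, s a a = 0) -> forall a c, s a c = 0.
Proof.
move=> sDl sDr sZl sZr s0 a c.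
have := s0 (fun k => a k + c k); rewrite !(sDl, sDr) !s0 add0r addr0 => E1.
have := s0 (fun k => a k + 'i * c k).
rewrite !(sDl, sDr) !(sZl, sZr) !s0 !mulr0 add0r addr0 conjCi => E2.
have E3 : 2 * 'i * s a c = 0.
  rewrite -[RHS](mulr0 'i) -[in RHS]E1 -[LHS]subr0 -[in LHS]oppr0 -E2; ring.
by apply/eqP; move/eqP: E3; rewrite !mulf_eq0 pnatr_eq0 (negPf (neq0Ci _)).
Qed.

Lemma pluckerDl a a' b : plucker (fun k => a k + a' k) b = plucker a b + plucker a' b.
Proof. by apply/rowP=> -[[|[|[|[|[|[|//]]]]]] ?]; rewrite !mxE /=; ring. Qed.

Lemma pluckerZl x a b : plucker (fun k => x * a k) b = x *: plucker a b.
Proof. by apply/rowP=> -[[|[|[|[|[|[|//]]]]]] ?]; rewrite !mxE /=; ring. Qed.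

Lemma pluckerC a b : plucker a b = - plucker b a.
Proof. by apply/rowP=> -[[|[|[|[|[|[|//]]]]]] ?]; rewrite !mxE /=; ring. Qed.

Lemma pluckerDr a b b' : plucker a (fun k => b k + b' k) = plucker a b + plucker a b'.
Proof. by rewrite !(pluckerC a) pluckerDl opprD. Qed.

Lemma pluckerZr x a b : plucker a (fun k => x * b k) = x *: plucker a b.
Proof. by rewrite !(pluckerC a) pluckerZl scalerN. Qed.

Lemma plucker_delta (J : 'I_6) : exists a, exists b, plucker a b = delta_mx 0 J.
Proof.
pose p := [:: 0; 0; 0; 1; 1; 2]%N`_J; pose q := [:: 1; 2; 3; 2; 3; 3]%N`_J.
exists (fun k => (k == p)%:R), (fun k => (k == q)%:R); rewrite {}/p {}/q.
apply/rowP; case: J => -[|[|[|[|[|[|//]]]]]] ?;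
by case=> -[|[|[|[|[|[|//]]]]]] ?; rewrite !mxE /=; ring.
Qed.

(** The form [A - A^t*] vanishes at every decomposable vector. Polarizing in the first factor, then
    in the second, kills it on all pairs of decomposable vectors, which include the coordinate
    basis. *)
Lemma plucker_real_hermitian (A : 'M[C]_6) :
  (forall a b, (plucker a b *m A *m (plucker a b)^t*) 0 0 \is Num.real) ->
  A^t* = A.
Proof.
move=> Ar; pose M := A - A^t*.
pose s a b c d := (plucker a b *m M *m (plucker c d)^t*) 0 0.
have s0 a b : s a b a b = 0.
  rewrite /s /M mulmxBr mulmxBl mxE [X in _ + X]mxE; apply/eqP; rewrite subr_eq0.
  have /CrealP rE := Ar a b; rewrite -{}rE.
  have -> : plucker a b *m A^t* *m (plucker a b)^t* =
            (plucker a b *m A *m (plucker a b)^t*)^t*.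
    by rewrite !trmxC_mul trmxCK mulmxA.
  by rewrite !mxE.
have s1 a b c : s a b c b = 0.
  apply: (polarization (s := fun a c => s a b c b)) => // [a1 a2 d|d c1 c2|x a1 d|x a1 d];
    rewrite /s ?pluckerDl ?pluckerZl.
  - by rewrite !mulmxDl mxE.
  - by rewrite [(_ + _)^T]linearD map_mxD mulmxDr mxE.
  - by rewrite -!scalemxAl mxE.
  - by rewrite [(_ *: _)^T]linearZ /= map_mxZ -scalemxAr mxE.
have s2 a b c d : s a b c d = 0.
  apply: (polarization (s := fun b d => s a b c d)) => // [a1 a2 e|e c1 c2|x a1 e|x a1 e];
    rewrite /s ?pluckerDr ?pluckerZr.
  - by rewrite !mulmxDl mxE.
  - by rewrite [(_ + _)^T]linearD map_mxD mulmxDr mxE.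
  - by rewrite -!scalemxAl mxE.
  - by rewrite [(_ *: _)^T]linearZ /= map_mxZ -scalemxAr mxE.
apply/esym/eqP; rewrite -subr_eq0; apply/eqP/matrixP => J K.
have [a [b abE]] := plucker_delta J; have [c [d cdE]] := plucker_delta K.
have := s2 a b c d; rewrite /s abE cdE -rowE trmx_delta map_delta_mx.
by rewrite -colE !mxE => ->.
Qed.

Lemma plucker_nonneg_trace (A : 'M[C]_6) :
  (forall a b, 0 <= (plucker a b *m A *m (plucker a b)^t*) 0 0) ->
  0 <= \tr (A *m klein *m A^T *m klein).
Proof.
move=> Apos; apply: isotropic_nonneg_trace.
- by apply: plucker_real_hermitian => a b; apply: ger0_real.
- exact: klein_tr.
- exact: klein_trC.
- exact: klein_sqr.
by move=> w /isotropic_plucker[a [b ->]].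
Qed.

End Plucker.

(** * The exterior algebra *)

(* [ext R[i] n] is convertible to [cform R n]. *)
Definition ext (C : numClosedFieldType) (n : nat) := {ffun {set gen n} -> C^o}.

Section ExteriorAlgebra.
Variables (C : numClosedFieldType) (n : nat).
Local Notation form := (ext C n).
Implicit Types (a b d : form) (A B D S : {set gen n}) (x y : gen n) (k : C).

HB.instance Definition _ := GRing.Lmodule.copy form {ffun {set gen n} -> C^o}.

(** Repeats [wsign] over an abstract field, so that over [R[i]] the product [emul] is convertible to
    [wedge]. *)
Definition esign A B : C :=
  (-1) ^+ #|[set p : gen n * gen n |
             (p.1 \in A) && (p.2 \in B) && (gidx p.2 < gidx p.1)%N]|.

Definition emul a b : form :=
  [ffun S => \sum_A \sum_(B | (A :|: B == S) && [disjoint A & B])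
               esign A B * a A * b B].

Lemma gidx_inj : injective (@gidx n).
Proof.
case=> i [] j /= ij.
- by congr inl; apply: val_inj.
- by have := ltn_ord i; rewrite ij ltnNge leq_addr.
- by have := ltn_ord j; rewrite -ij ltnNge leq_addr.
- by congr inr; apply: val_inj; apply: (addnI ij).
Qed.

Lemma esign_neq0 A B : esign A B != 0.
Proof. by rewrite signr_eq0. Qed.

Lemma esign_sqr A B : esign A B * esign A B = 1.
Proof. by rewrite /esign -expr2 sqrr_sign. Qed.

Lemma esignUl A B D : [disjoint A & B] ->
  esign (A :|: B) D = esign A D * esign B D.
Proof.
move=> dAB; rewrite /esign -exprD; congr (_ ^+ _).
rewrite -cardsUI [X in _ = (_ + #|pred_of_set X|)%N](_ : _ = set0); last first.
  apply/setP=> -[u v]; rewrite !inE /=; apply/negP.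
  case/andP=> /andP[/andP[uA _] _] /andP[/andP[uB _] _].
  by have /disjointFr/(_ uA) := dAB; rewrite uB.
rewrite cards0 addn0; apply: eq_card => -[u v]; rewrite !inE /=.
by case: (u \in A); case: (u \in B); case: (v \in D); case: (_ < _)%N.
Qed.

Lemma esignUr A B D : [disjoint B & D] ->
  esign A (B :|: D) = esign A B * esign A D.
Proof.
move=> dBD; rewrite /esign -exprD; congr (_ ^+ _).
rewrite -cardsUI [X in _ = (_ + #|pred_of_set X|)%N](_ : _ = set0); last first.
  apply/setP=> -[u v]; rewrite !inE /=; apply/negP.
  case/andP=> /andP[/andP[_ vB] _] /andP[/andP[_ vD] _].
  by have /disjointFr/(_ vB) := dBD; rewrite vD.
rewrite cards0 addn0; apply: eq_card => -[u v]; rewrite !inE /=.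
by case: (u \in A); case: (v \in B); case: (v \in D); case: (_ < _)%N.
Qed.

Lemma emulDl a b d : emul (a + b) d = emul a d + emul b d.
Proof.
apply/ffunP=> S; rewrite !ffunE -big_split; apply: eq_bigr => A _ /=.
by rewrite -big_split; apply: eq_bigr => B _ /=; rewrite ffunE mulrDr mulrDl.
Qed.

Lemma emulDr a b d : emul a (b + d) = emul a b + emul a d.
Proof.
apply/ffunP=> S; rewrite !ffunE -big_split; apply: eq_bigr => A _ /=.
by rewrite -big_split; apply: eq_bigr => B _ /=; rewrite ffunE mulrDr.
Qed.

Lemma emulZl k a b : emul (k *: a) b = k *: emul a b.
Proof.
apply/ffunP=> S; rewrite !ffunE scaler_sumr; apply: eq_bigr => A _ /=.
rewrite scaler_sumr; apply: eq_bigr => B _ /=.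
by rewrite ffunE !mulrA (mulrC _ k) -!mulrA.
Qed.

Lemma emulZr k a b : emul a (k *: b) = k *: emul a b.
Proof.
apply/ffunP=> S; rewrite !ffunE scaler_sumr; apply: eq_bigr => A _ /=.
rewrite scaler_sumr; apply: eq_bigr => B _ /=.
by rewrite ffunE mulrCA -!mulrA.
Qed.

Definition ebasis S : form := [ffun T => (T == S)%:R].

Lemma ebasis_sum a : a = \sum_S a S *: ebasis S.
Proof.
apply/ffunP=> T; rewrite sum_ffunE (bigD1 T) //= !ffunE eqxx big1 ?addr0.
  by rewrite -[LHS]mulr1.
by move=> S ST; rewrite !ffunE eq_sym (negPf ST) scaler0.
Qed.

Lemma emul_ebasis A B : emul (ebasis A) (ebasis B) =
  if [disjoint A & B] then esign A B *: ebasis (A :|: B) else 0.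
Proof.
apply/ffunP=> S; rewrite ffunE (bigD1 A) //= [X in _ + X]big1 ?addr0; last first.
  move=> A' A'A; rewrite big1 // => B' _.
  by rewrite !ffunE (negPf A'A) mulr0 mul0r.
rewrite big_mkcond (bigD1 B) //= [X in _ + X]big1 ?addr0; last first.
  move=> B' B'B; case: ifP => // _.
  by rewrite !ffunE (negPf B'B) mulr0.
case: ifPn => [/andP[/eqP <- ->]|]; rewrite ?ffunE ?eqxx ?mulr1 ?ffunE ?eqxx ?mulr1 //.
  by rewrite -[LHS]mulr1.
rewrite negb_and; case: ifP => dAB; last by rewrite ffunE.
by rewrite orbF !ffunE eq_sym => /negPf ->; rewrite scaler0.
Qed.

Lemma emul0l a : emul 0 a = 0.
Proof. by rewrite -[X in emul X _](scale0r 0) emulZl scale0r. Qed.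

Lemma emul0r a : emul a 0 = 0.
Proof. by rewrite -[X in emul _ X](scale0r 0) emulZr scale0r. Qed.

Lemma emul_suml (I : Type) (r : seq I) (F : I -> form) b :
  emul (\sum_(i <- r) F i) b = \sum_(i <- r) emul (F i) b.
Proof.
exact: (big_morph (fun a => emul a b) (fun a1 a2 => emulDl a1 a2 b) (emul0l b)).
Qed.

Lemma emul_sumr (I : Type) (r : seq I) (F : I -> form) a :
  emul a (\sum_(i <- r) F i) = \sum_(i <- r) emul a (F i).
Proof. exact: (big_morph (emul a) (emulDr a) (emul0r a)). Qed.

Lemma disjointsUl A B D :
  [disjoint A :|: B & D] = [disjoint A & D] && [disjoint B & D].
Proof. by rewrite -!setI_eq0 setIUl setU_eq0. Qed.

Lemma disjointsUr A B D :
  [disjoint A & B :|: D] = [disjoint A & B] && [disjoint A & D].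
Proof. by rewrite -!setI_eq0 setIUr setU_eq0. Qed.

(** Either bracketing yields the product of the three pairwise signs, since [esign] is
    multiplicative over disjoint unions in each argument. *)
Lemma emul_ebasisA A B D : emul (ebasis A) (emul (ebasis B) (ebasis D)) =
  emul (emul (ebasis A) (ebasis B)) (ebasis D).
Proof.
rewrite !emul_ebasis.
case: (boolP [disjoint A & B]) => dAB; case: (boolP [disjoint B & D]) => dBD;
  rewrite ?emulZl ?emulZr ?emul0l ?emul0r // ?emul_ebasis.
- rewrite disjointsUl disjointsUr dAB dBD /= andbT.
  case: ifP => _; last by rewrite !scaler0.
  rewrite !scalerA setUA esignUl // esignUr //; congr (_ *: _).
  by rewrite mulrC mulrA.
- by rewrite disjointsUl (negPf dBD) andbF scaler0.
- by rewrite disjointsUr (negPf dAB) scaler0.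
Qed.

Lemma emulA : associative emul.
Proof.
move=> a b d; rewrite [a]ebasis_sum !emul_suml; apply: eq_bigr => A _.
rewrite [b]ebasis_sum emul_suml !emul_sumr emul_suml; apply: eq_bigr => B _.
rewrite [d]ebasis_sum !emul_sumr; apply: eq_bigr => D _.
rewrite !(emulZl, emulZr) emul_ebasisA !scalerA; congr (_ *: _).
by rewrite mulrC mulrA.
Qed.

Definition ext1 : form := ebasis set0.

Lemma ext1E : ext1 = ebasis set0.
Proof. by []. Qed.

Lemma emul1l : left_id ext1 emul.
Proof.
move=> a; rewrite [a]ebasis_sum emul_sumr; apply: eq_bigr => S _.
rewrite emulZr ext1E emul_ebasis -setI_eq0 set0I eqxx set0U.
rewrite /esign (_ : [set _ | _] = set0) ?cards0 ?scale1r //.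
by apply/setP=> p; rewrite !inE.
Qed.

Lemma emul1r : right_id ext1 emul.
Proof.
move=> a; rewrite [a]ebasis_sum emul_suml; apply: eq_bigr => S _.
rewrite emulZl ext1E emul_ebasis -setI_eq0 setI0 eqxx setU0.
rewrite /esign (_ : [set _ | _] = set0) ?cards0 ?scale1r //.
by apply/setP=> p; rewrite !inE andbF.
Qed.

Lemma ext1_neq0 : ext1 != 0.
Proof.
apply/eqP=> /ffunP/(_ set0); rewrite !ffunE eqxx.
by move/eqP; rewrite oner_eq0.
Qed.

HB.instance Definition _ := GRing.Zmodule_isNzRing.Build form
  emulA emul1l emul1r emulDl (fun a b d => emulDr a b d) ext1_neq0.
HB.instance Definition _ := GRing.Lmodule_isLalgebra.Build C form
  (fun k a b => esym (emulZl k a b)).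
HB.instance Definition _ := GRing.Lalgebra_isAlgebra.Build C form
  (fun k a b => esym (emulZr k a b)).

Lemma emulE a b : emul a b = a * b.
Proof. by []. Qed.

Definition egen x : form := ebasis [set x].

Lemma egen_ebasis x S : x \notin S ->
  egen x * ebasis S = esign [set x] S *: ebasis (x |: S).
Proof. by move=> xS; rewrite -emulE emul_ebasis disjoints1 xS. Qed.

Lemma ebasis_setU1 x S : x \notin S ->
  ebasis (x |: S) = esign [set x] S *: (egen x * ebasis S).
Proof. by move=> xS; rewrite egen_ebasis // scalerA esign_sqr scale1r. Qed.

Lemma egen_ebasis0 x S : x \in S -> egen x * ebasis S = 0.
Proof. by move=> xS; rewrite -emulE emul_ebasis disjoints1 xS. Qed.

Lemma egenC x y : egen x * egen y = - (egen y * egen x).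
Proof.
have [->|xy] := eqVneq x y.
  by rewrite egen_ebasis0 ?set11 // oppr0.
rewrite !egen_ebasis ?inE // 1?eq_sym // setUC -scaleNr; congr (_ *: _).
have E u v : esign [set u] [set v] = (-1) ^+ (gidx v < gidx u)%N.
  rewrite /esign; congr (_ ^+ _).
  rewrite (_ : [set p | _] = if (gidx v < gidx u)%N then [set (u, v)] else set0).
    by case: ifP; rewrite ?cards1 ?cards0.
  apply/setP=> -[p q]; rewrite !inE /=.
  case: eqVneq => [->|pu]; case: (eqVneq q v) => [->|qv] //=;
    case: ifP => _; rewrite !inE // xpair_eqE ?eqxx ?(negPf qv) ?(negPf pu) ?andbF //.
rewrite !E; have : gidx x != gidx y by apply: contraNneq xy => /gidx_inj ->.
by case: ltngtP => //; rewrite ?expr0 ?expr1 ?opprK.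
Qed.

(** A basis monomial other than 1 is, up to sign, a generator times a shorter monomial. *)
Lemma ext_ind (P : form -> Prop) :
    P 1 -> (forall x a, P a -> P (egen x * a)) ->
    (forall k a, P a -> P (k *: a)) -> (forall a b, P a -> P b -> P (a + b)) ->
  forall a, P a.
Proof.
move=> P1 PM PZ PD a; rewrite [a]ebasis_sum.
apply: big_ind => [|//|S _]; first by rewrite -(scale0r 1); apply: PZ.
apply: (PZ); have [m] := ubnP #|S|; elim: m S => // m IHm S Sm.
have [->//|[x xS]] := set_0Vmem S.
rewrite -(setD1K xS) ebasis_setU1 ?setD11 //; apply/PZ/PM/IHm.
by move: Sm; rewrite (cardsD1 x) xS.
Qed.

End ExteriorAlgebra.

(** * Products of pairs of alternating elements *)

Section KleinPairs.
Variables (C : numClosedFieldType) (A : algType C).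
Implicit Types (a b : nat -> C) (x y : nat -> A).

Definition pairs x (J : 'I_6) : A :=
  [:: x 0%N * x 1%N; x 0%N * x 2%N; x 0%N * x 3%N;
      x 1%N * x 2%N; x 1%N * x 3%N; x 2%N * x 3%N]`_J.

Definition quad x : A := x 0%N * (x 1%N * (x 2%N * x 3%N)).

Section Alternating.
Variable x : nat -> A.
Hypothesis xx : forall s, x s * x s = 0.
Hypothesis xC : forall s t, x s * x t = - (x t * x s).

Lemma alt_mulA s t z : x s * (x t * z) = - (x t * (x s * z)).
Proof. by rewrite mulrA xC mulNr mulrA. Qed.

Lemma alt_sqrA s z : x s * (x s * z) = 0.
Proof. by rewrite mulrA xx mul0r. Qed.

(** Overlapping pairs repeat a factor and vanish; complementary pairs reorder to [quad x]. *)
Lemma pairs_mul J K : pairs x J * pairs x K = klein C J K *: quad x.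
Proof.
(* Every swap is oriented towards increasing indices, so the rewriting terminates; [alt_mulA] and
   [alt_sqrA] act inside longer products. *)
pose rules := (xC 1 0, xC 2 0, xC 3 0, xC 2 1, xC 3 1, xC 3 2,
  alt_mulA 1 0, alt_mulA 2 0, alt_mulA 3 0, alt_mulA 2 1, alt_mulA 3 1, alt_mulA 3 2,
  xx, alt_sqrA)%N.
rewrite mxE /pairs /klein_sign /quad.
move: J K => -[[|[|[|[|[|[|//]]]]]] ?] -[[|[|[|[|[|[|//]]]]]] ?] /=; rewrite -!mulrA;
  by rewrite ?(mulr0, mul0r, mulrN, mulNr, opprK, oppr0, rules)
       ?mulr0n ?mulr1n ?scale0r ?scale1r ?scaleN1r.
Qed.

Lemma comb_mul a b :
  (\sum_(s < 4) a s *: x s) * (\sum_(s < 4) b s *: x s) =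
  \sum_J plucker a b 0 J *: pairs x J.
Proof.
rewrite !big_ord_recl !big_ord0 /= !mxE /pairs /= /bump /= !addr0 !addn0 !add1n.
rewrite !mulrDl !mulrDr -!scalerAl -!scalerAr !xx !scalerA !scaler0 !addr0 !add0r.
rewrite (xC 1 0) (xC 2 0) (xC 3 0) (xC 2 1) (xC 3 1) (xC 3 2) !scalerN !scalerBl.
(* The permutation puts each term [(s, t)] next to the term [(t, s)]. *)
by rewrite !addrA [LHS](ACl (1*4*2*7*3*10*5*8*6*11*9*12)).
Qed.

End Alternating.

Definition tensor x y (M : 'M[C]_6) : A :=
  \sum_J \sum_K M J K *: (pairs x J * pairs y K).

Lemma tensor_outer x y (p q : 'rV[C]_6) :
  (\sum_J p 0 J *: pairs x J) * (\sum_K q 0 K *: pairs y K) =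
  tensor x y (p^T *m q).
Proof.
rewrite mulr_suml; apply: eq_bigr => J _; rewrite mulr_sumr; apply: eq_bigr => K _.
by rewrite -scalerAl -scalerAr scalerA !mxE big_ord1 !mxE.
Qed.

(** Pairs in [y] commute with pairs in [x], so the two wedge pairings separate and each contributes
    a factor [klein]; the trace is the resulting double contraction of [M] with [N]. *)
Lemma tensor_mul x y (M N : 'M[C]_6) :
    (forall s, x s * x s = 0) -> (forall s t, x s * x t = - (x t * x s)) ->
    (forall s, y s * y s = 0) -> (forall s t, y s * y t = - (y t * y s)) ->
    (forall s t, y s * x t = - (x t * y s)) ->
  tensor x y M * tensor x y N =
  \tr (M *m klein C *m N^T *m klein C) *: (quad x * quad y).
Proof.
move=> xx xC yy yC yx.
have pC K L : pairs y K * pairs x L = pairs x L * pairs y K.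
  have ypC s t u : y s * (x t * x u) = x t * x u * y s.
    by rewrite mulrA yx mulNr -!mulrA yx mulrN opprK.
  have pE z (J : 'I_6) : exists s t, pairs z J = z s * z t :> A.
    by case: J => -[|[|[|[|[|[|//]]]]]] ?; rewrite /pairs /=; do 2!eexists.
  have [s [t ->]] := pE y K; have [s' [t' ->]] := pE x L.
  by rewrite -[LHS]mulrA ypC [LHS]mulrA ypC -[LHS]mulrA.
have mulE J K L P : pairs x J * pairs y K * (pairs x L * pairs y P) =
    (klein C J L * klein C K P) *: (quad x * quad y).
  rewrite mulrA -(mulrA (pairs x J)) pC mulrA -mulrA !pairs_mul //.
  by rewrite -scalerAl -scalerAr scalerA.
rewrite /mxtrace scaler_suml mulr_suml; apply: eq_bigr => J _.
rewrite [(_ *m klein C) _ _]mxE scaler_suml mulr_suml.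
transitivity (\sum_K \sum_L \sum_P
    (M J K * N L P * (klein C J L * klein C K P)) *: (quad x * quad y)).
  apply: eq_bigr => K _; rewrite mulr_sumr; apply: eq_bigr => L _.
  rewrite mulr_sumr; apply: eq_bigr => P _.
  by rewrite -scalerAl -scalerAr mulE !scalerA.
rewrite exchange_big; apply: eq_bigr => L _ /=.
rewrite exchange_big [(_ *m N^T) _ _]mxE mulr_suml scaler_suml; apply: eq_bigr => P _ /=.
rewrite [(_ *m klein C) _ _]mxE !mulr_suml scaler_suml; apply: eq_bigr => K _.
have -> : klein C J L = klein C L J by rewrite -[in LHS](klein_tr C) mxE.
by congr (_ *: _); rewrite [N^T _ _]mxE; ring.
Qed.

End KleinPairs.

(** * Positive forms over a closed field *)

Section Forms.
Variables (C : numClosedFieldType) (n : nat).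
(** The imaginary unit is any square root of -1, so that [Complex 0 1] can be substituted
    directly. *)
Variables (I : C) (I_sqr : I * I = -1).
Local Notation form := (ext C n).
Local Notation vec := ('I_n -> C).
Implicit Types (a b : form) (c g : vec) (k : C).

Definition lform c : form := \sum_j c j *: egen C (inl j).
Definition lbar c : form := \sum_j (c j)^* *: egen C (inr j).
Definition iform c : form := I *: (lform c * lbar c).

(** Common source of the sign rules for [lform] and [lbar]; a one-point index type gives the case of
    a single generator. *)
Lemma span_anticomm (J K : finType) (p : J -> C) (q : K -> C)
    (u : J -> gen n) (v : K -> gen n) :
  (\sum_j p j *: egen C (u j)) * (\sum_l q l *: egen C (v l)) =
  - ((\sum_l q l *: egen C (v l)) * (\sum_j p j *: egen C (u j))) :> form.
Proof.
rewrite mulr_suml mulr_suml -sumrN; under eq_bigr do rewrite mulr_sumr.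
rewrite exchange_big; apply: eq_bigr => l _ /=.
rewrite mulr_sumr -sumrN; apply: eq_bigr => j _.
by rewrite -!scalerAl -!scalerAr egenC !scalerN !scalerA mulrC.
Qed.

Lemma lformC c g : lform c * lform g = - (lform g * lform c).
Proof. exact: span_anticomm. Qed.

Lemma lbarC c g : lbar c * lbar g = - (lbar g * lbar c).
Proof. exact: span_anticomm. Qed.

Lemma lbar_lform c g : lbar c * lform g = - (lform g * lbar c).
Proof. exact: span_anticomm. Qed.

Lemma oppr_eq_ext a : a = - a -> a = 0.
Proof.
move/eqP; rewrite -addr_eq0 -mulr2n -scaler_nat scaler_eq0 pnatr_eq0 /=.
by move/eqP.
Qed.

Lemma lform_sqr c : lform c * lform c = 0.
Proof. exact/oppr_eq_ext/lformC. Qed.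

Lemma lbar_sqr c : lbar c * lbar c = 0.
Proof. exact/oppr_eq_ext/lbarC. Qed.

(** A generator passes two factors of degree one, and the two signs cancel. *)
Lemma iform_central c a : iform c * a = a * iform c.
Proof.
rewrite /iform -scalerAl -scalerAr; congr (_ *: _).
elim/ext_ind: a => [|x a IHa|k a IHa|a b IHa IHb].
- by rewrite mulr1 mul1r.
- have X1 : lform c * egen C x = - (egen C x * lform c).
    have := span_anticomm c (fun _ : unit => 1) inl (fun _ => x).
    by rewrite (big_pred1 tt) ?scale1r //; case.
  have X2 : lbar c * egen C x = - (egen C x * lbar c).
    have := span_anticomm (fun j => (c j)^*) (fun _ : unit => 1) inr (fun _ => x).
    by rewrite (big_pred1 tt) ?scale1r //; case.
  by rewrite -[RHS]mulrA -IHa !mulrA -(mulrA _ _ (egen C x)) X2 mulrN mulrA X1 !mulNr opprK.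
- by rewrite -scalerAr -scalerAl IHa.
- by rewrite mulrDr mulrDl IHa IHb.
Qed.

Lemma prod_iform_central (J : Type) (s : seq J) (g : J -> vec) a :
  (\prod_(j <- s) iform (g j)) * a = a * \prod_(j <- s) iform (g j).
Proof.
elim: s => [|j s IHs]; first by rewrite big_nil mul1r mulr1.
by rewrite big_cons -mulrA IHs !mulrA iform_central.
Qed.

Lemma lform_iform c : lform c * iform c = 0.
Proof. by rewrite /iform -scalerAr mulrA lform_sqr mul0r scaler0. Qed.

Lemma lbar_iform c : lbar c * iform c = 0.
Proof.
by rewrite /iform -scalerAr mulrA lbar_lform mulNr -mulrA lbar_sqr mulr0 oppr0 scaler0.
Qed.

Lemma prod_iform_rem (J : eqType) (s : seq J) (g : J -> vec) j : j \in s ->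
  \prod_(l <- s) iform (g l) = iform (g j) * \prod_(l <- rem j s) iform (g l).
Proof.
elim: s => // l s IHs; rewrite inE big_cons /=.
have [->//|_ /= /IHs ->] := eqVneq l j.
by rewrite big_cons !mulrA iform_central.
Qed.

(** Multiplication by the product thus acts as reduction modulo the [g j]. *)
Lemma lform_prod_iform (J : eqType) (s : seq J) (g : J -> vec) j : j \in s ->
  lform (g j) * \prod_(l <- s) iform (g l) = 0.
Proof. by move=> js; rewrite (prod_iform_rem _ js) mulrA lform_iform mul0r. Qed.

Lemma lbar_prod_iform (J : eqType) (s : seq J) (g : J -> vec) j : j \in s ->
  lbar (g j) * \prod_(l <- s) iform (g l) = 0.
Proof. by move=> js; rewrite (prod_iform_rem _ js) mulrA lbar_iform mul0r. Qed.

Lemma lform_comb (J : finType) (p : J -> C) (g : J -> vec) c :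
  (forall j, c j = \sum_l p l * g l j) -> lform c = \sum_l p l *: lform (g l).
Proof.
move=> cE; rewrite /lform; under eq_bigr do rewrite cE scaler_suml.
rewrite exchange_big; apply: eq_bigr => l _; rewrite scaler_sumr.
by apply: eq_bigr => j _; rewrite scalerA.
Qed.

Lemma lbar_comb (J : finType) (p : J -> C) (g : J -> vec) c :
  (forall j, c j = \sum_l p l * g l j) -> lbar c = \sum_l (p l)^* *: lbar (g l).
Proof.
move=> cE; rewrite /lbar; under eq_bigr do rewrite cE rmorph_sum scaler_suml.
rewrite exchange_big; apply: eq_bigr => l _; rewrite scaler_sumr.
by apply: eq_bigr => j _; rewrite scalerA rmorphM.
Qed.

(* If [Pi iform (g j)] does not vanish then the [g j] are independent, hence can be
   completed to a basis by [r] vectors. *)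
Lemma prod_iform_complete m r (g : 'I_m -> vec) : (m + r)%N = n ->
  \prod_(j <- enum 'I_m) iform (g j) = 0 \/
  exists v : nat -> vec, forall c, exists p : nat -> C, exists q : 'I_m -> C,
    forall j, c j = \sum_(s < r) p s * v s j + \sum_l q l * g l j.
Proof.
move=> mrn; pose G := \matrix_(j, l) g j l : 'M[C]_(m, n).
have [Gfree|/row_freePn[i /submxP[D iE]]] := boolP (row_free G); [right|left]; last first.
  rewrite (prod_iform_rem g (mem_enum _ i)).
  have gE j : g i j = \sum_l D 0 l * g (lift i l) j.
    have := congr1 (fun M : 'rV_n => M 0 j) iE; rewrite !mxE => ->.
    by apply: eq_bigr => l _; rewrite !mxE.
  (* The remaining factors are moved next to [lform (g i)], a combination of forms that they
     annihilate. *)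
  rewrite {1}/iform -scalerAl -mulrA -prod_iform_central mulrA (lform_comb gE).
  rewrite mulr_suml big1 ?mul0r ?scaler0 // => l _.
  rewrite -scalerAl lform_prod_iform ?scaler0 //.
  by rewrite rem_filter ?enum_uniq // mem_filter mem_enum /= eq_sym neq_lift.
have [t [V [tr VG]]] : exists t, exists V : 'M[C]_(t, n), t = r /\ (1%:M <= V + G)%MS.
  (* A basis of a complement of the row space; freeness of [G] makes its size [n - m = r]. *)
  exists (\rank G^C), (row_base G^C%MS); split.
    rewrite mxrank_compl; move: Gfree; rewrite /row_free => /eqP ->.
    by rewrite -mrn addKn.
  rewrite (adds_eqmx (eq_row_base _) (eqmx_refl G)).
  by rewrite addsmxC; apply: submx_full; rewrite addsmx_compl_full.
(* The family is indexed by [nat], with value 0 from [r] on; a sum over [s < r] meets only true rows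
   of [V]. *)
subst t; exists (fun s j => if insub s is Some s' then V s' j else 0) => c.
have /sub_addsmxP[[P Q] /= E] : (\row_j c j <= V + G)%MS.
  by apply: submx_trans VG; rewrite submx1.
exists (fun s => if insub s is Some s' then P 0 s' else 0), (fun l => Q 0 l) => j.
have := congr1 (fun M : 'rV_n => M 0 j) E; rewrite !mxE => ->; congr (_ + _).
  by apply: eq_bigr => s _; rewrite valK.
by apply: eq_bigr => l _; rewrite !mxE.
Qed.

(** * Products of top degree and the volume form *)

Fixpoint phase (m : nat) : C :=
  if m is m'.+1 then I * (-1) ^+ m' * phase m' else 1.

Lemma lbar_prod_lform c (cs : seq vec) :
  lbar c * \prod_(g <- cs) lform g =
  (-1) ^+ size cs *: (\prod_(g <- cs) lform g * lbar c).
Proof.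
elim: cs => [|g cs IHcs] /=; first by rewrite big_nil mul1r mulr1 scale1r.
rewrite big_cons mulrA lbar_lform mulNr -!mulrA IHcs -scalerAr exprS.
by rewrite -scalerA scaleN1r.
Qed.

(** Each [lbar] crosses the [lform] factors that follow it, whence [phase m] is
    [I^m (-1)^(m(m-1)/2)]. *)
Lemma prod_iform_split (cs : seq vec) : \prod_(g <- cs) iform g =
  phase (size cs) *: (\prod_(g <- cs) lform g * \prod_(g <- cs) lbar g).
Proof.
elim: cs => [|c cs IHcs] /=; first by rewrite !big_nil mulr1 scale1r.
rewrite !big_cons IHcs /iform -scalerAl -scalerAr -!mulrA (mulrA (lbar c)).
rewrite lbar_prod_lform -scalerAl -scalerAr !scalerA; congr (_ *: _); last first.
  by rewrite !mulrA.
by ring.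
Qed.

(** The sign depends on indices alone, so it is shared by monomials in [dz] and in their
    conjugates. *)
Definition insert_sign (i : 'I_n) (S : {set 'I_n}) : C :=
  if i \in S then 0 else (-1) ^+ #|[set j in S | (j < i)%N]|.

Lemma conj_insert_sign i S : (insert_sign i S)^* = insert_sign i S.
Proof.
rewrite /insert_sign; case: ifP => _; first by rewrite rmorph0.
by rewrite rmorph_sign.
Qed.

Section Injection.
Variable iota : 'I_n -> gen n.
Hypothesis iota_inj : injective iota.
Hypothesis iota_mono : forall i j, (gidx (iota i) < gidx (iota j))%N = (i < j)%N.

Lemma egen_insert (i : 'I_n) (S : {set 'I_n}) :
  egen C (iota i) * ebasis C (iota @: S) =
  insert_sign i S *: ebasis C (iota @: (i |: S)).
Proof.
rewrite /insert_sign; case: ifP => iS.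
  by rewrite scale0r egen_ebasis0 // imset_f.
rewrite egen_ebasis; last by rewrite (mem_imset _ _ iota_inj) iS.
rewrite imsetU1; congr (_ *: _); rewrite /esign; congr (_ ^+ _).
pose f (j : 'I_n) := (iota i, iota j).
have f_inj : injective f by move=> j1 j2 [/iota_inj].
rewrite -(card_imset _ f_inj); apply: eq_card => -[u v]; rewrite !inE /=.
apply/idP/imsetP => [/andP[/andP[/eqP -> /imsetP[j jS ->]] ji]|[j]].
  by exists j => //; rewrite inE jS -iota_mono.
by rewrite inE => /andP[jS ji] [-> ->]; rewrite eqxx imset_f //= iota_mono.
Qed.

Lemma span_mul_expand (p : 'I_n -> C) (K : {set 'I_n} -> C) :
  (\sum_j p j *: egen C (iota j)) * (\sum_S K S *: ebasis C (iota @: S)) =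
  \sum_S (\sum_j \sum_(S' | j |: S' == S) p j * K S' * insert_sign j S') *:
    ebasis C (iota @: S).
Proof.
rewrite mulr_suml; under [RHS]eq_bigr do rewrite scaler_suml.
rewrite [RHS]exchange_big; apply: eq_bigr => j _ /=.
rewrite mulr_sumr (partition_big (fun S' => j |: S') predT) //=.
apply: eq_bigr => S _; rewrite scaler_suml; apply: eq_bigr => S' /eqP <-.
by rewrite -scalerAl -scalerAr egen_insert !scalerA.
Qed.

End Injection.

Lemma inr_mono (i j : 'I_n) : (@gidx n (inr i) < gidx (inr j))%N = (i < j)%N.
Proof. by rewrite /= ltn_add2l. Qed.

(* The same coefficients serve for [lform] and, conjugated, for [lbar]: this replaces
   the expansion of both products by determinants. *)
Lemma prod_lform_expand (cs : seq vec) : exists K : {set 'I_n} -> C,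
  [/\ forall S : {set 'I_n}, #|S| != size cs -> K S = 0,
      \prod_(c <- cs) lform c = \sum_S K S *: ebasis C (inl @: S) &
      \prod_(c <- cs) lbar c = \sum_S (K S)^* *: ebasis C (inr @: S)].
Proof.
elim: cs => [|c cs [K [K0 Kl Kr]]].
  exists (fun S => (S == set0)%:R); split.
  - by move=> S; rewrite cards_eq0 => /negPf ->.
  - rewrite big_nil (bigD1 set0) //= eqxx scale1r imset0 big1 ?addr0 //.
    by move=> S /negPf ->; rewrite scale0r.
  - rewrite big_nil (bigD1 set0) //= eqxx rmorph1 scale1r imset0 big1 ?addr0 //.
    by move=> S /negPf ->; rewrite rmorph0 scale0r.
exists (fun S => \sum_j \sum_(S' | j |: S' == S) c j * K S' * insert_sign j S'); split.
- move=> S Sc; rewrite big1 // => j _; rewrite big1 // => S' /eqP SE.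
  rewrite /insert_sign; case: ifPn => jS'; first by rewrite mulr0.
  rewrite K0 ?mulr0 ?mul0r //; apply: contraNneq Sc => S'c.
  by rewrite -SE cardsU1 jS' S'c.
- by rewrite big_cons Kl (span_mul_expand (iota := inl)) //; apply: inl_inj.
rewrite big_cons Kr (span_mul_expand (iota := inr)); [|exact: inr_inj|exact: inr_mono].
apply: eq_bigr => S _; congr (_ *: _); rewrite rmorph_sum; apply: eq_bigr => j _.
rewrite rmorph_sum; apply: eq_bigr => S' _.
by rewrite !rmorphM /= conj_insert_sign.
Qed.

(** Only the full index set survives in top degree; its two coefficients are conjugate, so [k] is a
    squared modulus, in effect that of a determinant. *)
Lemma prod_iform_top (cs : seq vec) : size cs = n -> exists2 k, 0 <= k &
  \prod_(c <- cs) iform c =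
    k *: (phase n *: (ebasis C (inl @: setT) * ebasis C (inr @: setT))).
Proof.
move=> csn; have [K [K0 Kl Kr]] := prod_lform_expand cs.
exists (K setT * (K setT)^*); first exact: mul_conjC_ge0.
have KT S : S != setT -> K S = 0.
  move=> ST; apply: K0; apply: contraNneq ST; rewrite csn => Sn.
  by rewrite eqEcard subsetT cardsT card_ord Sn leqnn.
rewrite prod_iform_split csn Kl Kr.
rewrite (bigD1 setT) //= big1 ?addr0 => [|S /KT ->]; last by rewrite scale0r.
rewrite (bigD1 setT) //= big1 ?addr0 => [|S /KT ->]; last by rewrite rmorph0 scale0r.
by rewrite -scalerAl -scalerAr !scalerA; congr (_ *: _); ring.
Qed.

Definition unit_vec (j : 'I_n) : vec := fun l => (l == j)%:R.

Definition volume : form := \prod_(j <- enum 'I_n) iform (unit_vec j).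

Lemma lform_unit j : lform (unit_vec j) = egen C (inl j).
Proof.
rewrite /lform (bigD1 j) //= big1 ?addr0 /unit_vec ?eqxx ?scale1r // => l /negPf ->.
by rewrite scale0r.
Qed.

Lemma lbar_unit j : lbar (unit_vec j) = egen C (inr j).
Proof.
rewrite /lbar (bigD1 j) //= big1 ?addr0 /unit_vec ?eqxx ?rmorph1 ?scale1r //.
by move=> l /negPf ->; rewrite rmorph0 scale0r.
Qed.

(** Each factor brings two fresh generators, so the product stays a nonzero multiple of a single
    monomial. *)
Lemma volume_neq0 : volume != 0.
Proof.
have I0 : I != 0.
  by apply: contra_eqN I_sqr => /eqP ->; rewrite mul0r eq_sym oppr_eq0 oner_eq0.
have ebasis_neq0 (S : {set gen n}) : ebasis C S != 0.
  apply/eqP=> /ffunP/(_ S); rewrite !ffunE eqxx => /eqP.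
  by rewrite oner_eq0.
have [z [S [z0 _ ->]]] : exists z : C, exists S : {set gen n}, [/\ z != 0,
    forall x, x \in S = (match x with inl j | inr j => j end \in enum 'I_n) &
    volume = z *: ebasis C S].
  rewrite /volume; elim: (enum 'I_n) (enum_uniq 'I_n) => [|j s IHs] /=.
    exists 1, set0; rewrite oner_neq0 big_nil scale1r; split=> // x.
    by rewrite !inE.
  case/andP=> js /IHs[z [S [z0 SE prodE]]].
  have Sr : inr j \notin S by rewrite SE.
  have Sl : inl j \notin inr j |: S by rewrite !inE SE.
  exists (I * (z * (esign C [set inr j] S * esign C [set inl j] (inr j |: S)))),
    (inl j |: (inr j |: S)); split.
  - by rewrite !mulf_neq0 ?esign_neq0.
  - by case=> l; rewrite !inE SE.
  rewrite big_cons prodE /iform lform_unit lbar_unit -scalerAl -scalerAr -mulrA.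
  by rewrite egen_ebasis // -scalerAr egen_ebasis // !scalerA !mulrA.
by rewrite scaler_eq0 negb_or z0 ebasis_neq0.
Qed.

(** The product and [volume] are nonnegative multiples of the same top form, and the second multiple
    is nonzero. *)
Lemma prod_iform_volume (cs : seq vec) : size cs = n -> exists2 k, 0 <= k &
  \prod_(c <- cs) iform c = k *: volume.
Proof.
case/prod_iform_top => k k0 ->.
have [|k1 k10] := @prod_iform_top [seq unit_vec j | j <- enum 'I_n].
  by rewrite size_map size_enum_ord.
rewrite big_map -/volume => volE.
have k1n0 : k1 != 0.
  by apply: contraNneq volume_neq0 => k1E; rewrite volE k1E scale0r.
exists (k / k1); first by rewrite divr_ge0.
by rewrite volE scalerA divfK.
Qed.

(** * Bidegree, and squares of forms of bidegree (2,2) *)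

Definition bidegree (p q : nat) a := forall S, a S != 0 ->
  #|[set j : 'I_n | inl j \in S]| = p /\ #|[set j : 'I_n | inr j \in S]| = q.

Lemma bidegreeM p q r s a b :
  bidegree p q a -> bidegree r s b -> bidegree (p + r) (q + s) (a * b).
Proof.
move=> aD bD S; rewrite -emulE ffunE => abS.
have [A [B [/eqP <- dAB aA bB]]] : exists A, exists B,
    [/\ A :|: B == S, [disjoint A & B], a A != 0 & b B != 0].
  have [A _ /eqP AS] : exists2 A, true & \sum_(B | (A :|: B == S) && [disjoint A & B])
      esign C A B * a A * b B != 0.
    apply/exists_inP; apply: contraNT abS; rewrite negb_exists_in => /forall_inP AS.
    by rewrite big1 // => A _; apply/eqP; rewrite -[_ == _]negbK AS.
  have /exists_inP[B /andP[BS dAB]] : [exists (B | (A :|: B == S) && [disjoint A & B]),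
      esign C A B * a A * b B != 0].
    apply: contraT; rewrite negb_exists_in => /forall_inP BS; case: AS.
    by rewrite big1 // => B BS'; apply/eqP; rewrite -[_ == _]negbK BS.
  rewrite !mulf_eq0 !negb_or => /andP[/andP[_ aA] bB].
  by exists A, B.
have [aA1 aA2] := aD _ aA; have [bB1 bB2] := bD _ bB.
have cardD (i : 'I_n -> gen n) : #|[set j | i j \in A :|: B]| =
    (#|[set j | i j \in A]| + #|[set j | i j \in B]|)%N.
  rewrite -cardsUI [X in _ = (_ + #|pred_of_set X|)%N](_ : _ = set0) ?cards0 ?addn0.
    by apply: eq_card => j; rewrite !inE.
  apply/setP=> j; rewrite !inE; apply/negP => /andP[jA jB].
  by have /disjointFr/(_ jA) := dAB; rewrite jB.
by rewrite !cardD aA1 aA2 bB1 bB2.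
Qed.

Lemma bidegree_eq0 p q a : (n < p)%N -> bidegree p q a -> a = 0.
Proof.
move=> np aD; apply/ffunP=> S; rewrite [RHS]ffunE; apply/eqP.
apply: contraLR np => /aD[<- _]; rewrite -leqNgt.
by rewrite -[X in (_ <= X)%N]card_ord max_card.
Qed.

Lemma bidegree22_ind (P : form -> Prop) :
    P 0 -> (forall a b, P a -> P b -> P (a + b)) ->
    (forall k a, P a -> P (k *: a)) ->
    (forall j1 j2 l1 l2, P (egen C (inl j1) * egen C (inl j2) *
                            (egen C (inr l1) * egen C (inr l2)))) ->
  forall a, bidegree 2 2 a -> P a.
Proof.
move=> P0 PD PZ PM a aD; rewrite [a]ebasis_sum; apply: big_ind => // S _.
have [->|/aD[]] := eqVneq (a S) 0; first by rewrite scale0r.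
move=> /eqP/cards2P[j1 [j2 [j12 jS]]] /eqP/cards2P[l1 [l2 [l12 lS]]].
have -> : S = [set inl j1; inl j2; inr l1; inr l2].
  apply/setP => -[j|l]; rewrite !inE.
    by have := congr1 (fun A : {set 'I_n} => j \in A) jS; rewrite !inE => ->; rewrite !orbF.
  by have := congr1 (fun A : {set 'I_n} => l \in A) lS; rewrite !inE => ->.
apply: (PZ).
rewrite -!setUA ebasis_setU1 ?ebasis_setU1 ?inE //=.
- by rewrite -!scalerAr; do 3!apply: (PZ); rewrite mulrA; apply: PM.
- by rewrite orbF; apply: contraNneq j12 => -[->].
Qed.

Lemma lform_add c c1 c2 :
  (forall j, c j = c1 j + c2 j) -> lform c = lform c1 + lform c2.
Proof.
move=> cE; rewrite /lform -big_split; apply: eq_bigr => j _.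
by rewrite cE scalerDl.
Qed.

Lemma lbar_add c c1 c2 :
  (forall j, c j = c1 j + c2 j) -> lbar c = lbar c1 + lbar c2.
Proof.
move=> cE; rewrite /lbar -big_split; apply: eq_bigr => j _.
by rewrite cE rmorphD scalerDl.
Qed.

Lemma square_nonneg m (g : 'I_m -> vec) a : (m + 4)%N = n -> bidegree 2 2 a ->
    (forall cs : seq vec, (size cs + 2)%N = n -> exists2 k, 0 <= k &
      a * \prod_(c <- cs) iform c = k *: volume) ->
  exists2 k, 0 <= k &
    a * a * \prod_(j <- enum 'I_m) iform (g j) = k *: volume.
Proof.
move=> mn aD apos; set T := \prod_(j <- _) _.
have [T0|[v vP]] := prod_iform_complete g mn.
  by exists 0; rewrite // /T T0 mulr0 scale0r.
have TC (b : form) : T * b = b * T := prod_iform_central _ _ b.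
(* Since [T] is central, equality after multiplication by [T] is compatible with products. *)
have mulT (b b' d d' : form) : b * T = b' * T -> d * T = d' * T -> b * d * T = b' * d' * T.
  by move=> bT dT; rewrite -mulrA dT -TC mulrA bT -mulrA TC mulrA.
pose e s := lform (v s); pose f s := lbar (v s).
have tens_mul M N := @tensor_mul C form e f M N (fun s => lform_sqr (v s))
  (fun s t => lformC (v s) (v t)) (fun s => lbar_sqr (v s))
  (fun s t => lbarC (v s) (v t)) (fun s t => lbar_lform (v s) (v t)).
have lcombE (p : nat -> C) : lform (fun j => \sum_(s < 4) p s * v s j) = \sum_(s < 4) p s *: e s.
  exact: (lform_comb (p := fun s : 'I_4 => p s) (g := fun s : 'I_4 => v s)).
have lbarE (p : nat -> C) : lbar (fun j => \sum_(s < 4) p s * v s j) = \sum_(s < 4) (p s)^* *: f s.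
  exact: (lbar_comb (p := fun s : 'I_4 => p s) (g := fun s : 'I_4 => v s)).
have plC (p q : nat -> C) : plucker (fun s => (p s)^*) (fun s => (q s)^*) =
    map_mx Num.conj (plucker p q).
  by apply/rowP=> -[[|[|[|[|[|[|//]]]]]] ?]; rewrite !mxE /= rmorphB !rmorphM.
have outerE (p q p' q' : nat -> C) :
    (\sum_(s < 4) p s *: e s) * (\sum_(s < 4) q s *: e s) *
    ((\sum_(s < 4) (p' s)^* *: f s) * (\sum_(s < 4) (q' s)^* *: f s)) =
    tensor e f ((plucker p q)^T *m map_mx Num.conj (plucker p' q')).
  rewrite comb_mul; [|by move=> s; exact: lform_sqr|by move=> s t; exact: lformC].
  rewrite (comb_mul (x := f) _ _ (fun s => (p' s)^*) (fun s => (q' s)^*));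
    [|by move=> s; exact: lbar_sqr|by move=> s t; exact: lbarC].
  by rewrite tensor_outer plC.
(* A coordinate covector is expanded in the completed basis, and [T] kills its part along the
   [g l]. *)
have genT j : exists p : nat -> C,
    egen C (inl j) * T = (\sum_(s < 4) p s *: e s) * T /\
    egen C (inr j) * T = (\sum_(s < 4) (p s)^* *: f s) * T.
  have [p [q pqE]] := vP (unit_vec j); exists p.
  rewrite -lform_unit -lbar_unit (lform_add pqE) (lbar_add pqE) lcombE lbarE.
  rewrite (lform_comb (fun j => erefl)) (lbar_comb (fun j => erefl)).
  split; rewrite mulrDl [X in _ + X]mulr_suml [X in _ + X]big1 ?addr0 // => l _.
    by rewrite -scalerAl lform_prod_iform ?scaler0 ?mem_enum.
  by rewrite -scalerAl lbar_prod_iform ?scaler0 ?mem_enum.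
have [M aM] : exists M, a * T = tensor e f M * T.
  move: a aD {apos}; apply: bidegree22_ind.
  - exists 0; rewrite mul0r /tensor big1 ?mul0r // => J _; rewrite big1 // => K _.
    by rewrite mxE scale0r.
  - move=> b b' [M bM] [M' bM']; exists (M + M'); rewrite mulrDl bM bM' -mulrDl.
    congr (_ * _); rewrite /tensor -big_split; apply: eq_bigr => J _.
    by rewrite -big_split; apply: eq_bigr => K _; rewrite mxE scalerDl.
  - move=> k b [M bM]; exists (k *: M); rewrite -scalerAl bM scalerAl.
    congr (_ * _); rewrite /tensor scaler_sumr; apply: eq_bigr => J _.
    by rewrite scaler_sumr; apply: eq_bigr => K _; rewrite mxE scalerA.
  move=> j1 j2 l1 l2.
  have [p1 [p1E _]] := genT j1; have [p2 [p2E _]] := genT j2.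
  have [q1 [_ q1E]] := genT l1; have [q2 [_ q2E]] := genT l2.
  exists ((plucker p1 p2)^T *m map_mx Num.conj (plucker q1 q2)).
  by rewrite -outerE; apply: (mulT); apply: (mulT).
(* As [phase 4 = I^4 (-1)^6 = 1], [quad e * quad f] is the product of the four [iform (v s)]. *)
have [k0 k0_ge0 k0E] : exists2 k, 0 <= k & quad e * quad f * T = k *: volume.
  have [|k k_ge0 kE] := prod_iform_volume
      (cs := [:: v 0; v 1; v 2; v 3]%N ++ [seq g j | j <- enum 'I_m]).
    by rewrite size_cat size_map size_enum_ord addnC.
  exists k; rewrite // -kE big_cat big_map; congr (_ * _).
  rewrite prod_iform_split !big_cons !big_nil !mulr1.
  have -> : phase 4 = 1 by rewrite /=; ring: I_sqr.
  by rewrite scale1r.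
have sqE : a * a * T = (\tr (M *m klein C *m M^T *m klein C) * k0) *: volume.
  by rewrite (mulT _ _ _ _ aM aM) tens_mul -scalerAl k0E scalerA.
have [k00|k0n0] := eqVneq k0 0.
  by exists 0; rewrite // sqE k00 mulr0.
have k0_gt0 : 0 < k0 by rewrite lt_def k0n0.
exists (\tr (M *m klein C *m M^T *m klein C) * k0) => //.
rewrite pmulr_lge0 //.
(* This is the form that positivity tests on decomposable vectors; since [klein] squares to 1,
   replacing [M] by [N] preserves the trace. *)
pose N := klein C *m M *m klein C.
have -> : \tr (M *m klein C *m M^T *m klein C) = \tr (N *m klein C *m N^T *m klein C).
  rewrite /N !trmx_mul klein_tr -!mulmxA (mulmxA (klein C) (klein C)) klein_sqr mul1mx.
  by rewrite mulmx1 [RHS]mxtrace_mulC !mulmxA.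
apply: plucker_nonneg_trace => p q.
pose P := plucker p q.
pose cp j := \sum_(s < 4) p s * v s j; pose cq j := \sum_(s < 4) q s * v s j.
have [|k k_ge0] := apos [:: cp, cq & [seq g j | j <- enum 'I_m]].
  by rewrite /= size_map size_enum_ord -mn -addn2 -addnA.
rewrite !big_cons big_map -/T.
have -> : iform cp * (iform cq * T) = tensor e f (P^T *m map_mx Num.conj P) * T.
  rewrite mulrA -outerE -!lcombE -!lbarE -/cp -/cq; congr (_ * _).
  (* The sign of [I * I] cancels the one from swapping [lbar cp] with [lform cq]. *)
  rewrite /iform -scalerAl -scalerAr scalerA I_sqr scaleN1r -!mulrA.
  by rewrite (mulrA (lbar cp)) lbar_lform mulNr mulrN opprK !mulrA.
rewrite mulrA (mulT _ _ _ _ aM erefl) tens_mul -scalerAl k0E scalerA.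
(* Since [volume] is nonzero, the two coefficients can be equated; the positive factor [k0] is then
   divided out. *)
move/eqP; rewrite -subr_eq0 -scalerBl scaler_eq0 (negPf volume_neq0) orbF.
rewrite subr_eq0 => /eqP trE; rewrite -(pmulr_lge0 _ k0_gt0).
suff -> : (P *m N *m P^t*) 0 0 =
    \tr (M *m klein C *m (P^T *m map_mx Num.conj P)^T *m klein C) by rewrite trE.
rewrite trmx_mul trmxK map_trmx /N.
have -> : P *m (klein C *m M *m klein C) *m P^t* =
    P *m klein C *m (M *m klein C *m P^t*) by rewrite !mulmxA.
by rewrite -trace_mx11 mxtrace_mulC !mulmxA.
Qed.

End Forms.

(** * Forms over R[i] *)

Section Bridge.
Variables (R : realType) (n : nat).
Local Notation C := (R[i] : numClosedFieldType).
Local Notation form := (ext C n).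
Local Notation I := (Complex 0 1 : C).

Lemma complex_I_sqr : I * I = -1.
Proof. by rewrite -expr2 sqr_i. Qed.

Lemma wedgeE (a b : cform R n) : wedge a b = (a : form) * (b : form).
Proof. by []. Qed.

Lemma scale_cformE k (a : cform R n) : k *: a = k *: (a : form).
Proof. by []. Qed.

Lemma form10E (c : 'I_n -> C) : form10 c = lform c :> form.
Proof.
apply/ffunP=> S; rewrite ffunE sum_ffunE; apply: eq_bigr => j _.
by rewrite !ffunE mulrC.
Qed.

Lemma conj10E (c : 'I_n -> C) : conj10 c = lbar c :> form.
Proof.
apply/ffunP=> S; rewrite ffunE sum_ffunE; apply: eq_bigr => j _.
by rewrite !ffunE mulrC.
Qed.

Lemma iggE (c : 'I_n -> C) : igg c = iform I c :> form.
Proof. by rewrite /igg wedgeE form10E conj10E. Qed.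

Lemma wedge_seq_igg (J : Type) (s : seq J) (g : J -> 'I_n -> C) :
  wedge_seq [seq igg (g j) | j <- s] = \prod_(j <- s) iform I (g j) :> form.
Proof.
by elim: s => [|j s IHs] /=; rewrite ?big_nil // big_cons -IHs -iggE.
Qed.

Lemma volE : vol R n = volume n I :> form.
Proof. exact: wedge_seq_igg. Qed.

(** Sequences in place of functions on ['I_(n - p)] let covectors be prepended without casts. *)
Lemma positive_form_seq p (a : cform R n) (cs : seq ('I_n -> C)) :
  positive_form p a -> (size cs + p)%N = n -> exists2 k : C, 0 <= k &
    (a : form) * \prod_(c <- cs) iform I c = k *: volume n I.
Proof.
move=> [_ apos] csn; have szcs : size cs = (n - p)%N.
  by rewrite -[size cs](addnK p) csn.
have [c [c_ge0 cE]] := apos (fun j => nth (fun=> 0) cs j).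
exists (real_complex R c); first by rewrite ler0c.
move: cE; rewrite wedgeE wedge_seq_igg volE => cE; rewrite -[RHS]cE; congr (_ * _).
have {1}-> : cs = [seq nth (fun=> 0) cs (val j) | j <- enum 'I_(n - p)].
  by rewrite (map_comp (nth _ cs) val) val_enum_ord -szcs map_nth_iota0 // take_size.
by rewrite big_map.
Qed.

End Bridge.

Theorem theorem1 (R : realType) (n : nat) (hn : (1 <= n)%N) (alpha : cform R n) :
  positive_form 2 alpha -> positive_form 4 (wedge alpha alpha).
Proof.
move=> apos; have aD : bidegree 2 2 (alpha : ext R[i] n) := apos.1.
have aaD := bidegreeM aD aD; split=> [//|g].
(* Below dimension 4 the subtraction [n - 4] truncates to 0, but a form of bidegree (4,4) vanishes
   there. *)
have [n4|n4] := ltnP n 4.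
  exists 0; split=> //; have aa0 := bidegree_eq0 n4 aaD.
  by rewrite wedgeE (wedgeE alpha) aa0 mul0r scale_cformE scale0r.
have [k k_ge0 kE] := square_nonneg (complex_I_sqr R) g (subnK n4) aD
  (fun cs => positive_form_seq apos).
(* The order on [R[i]] makes a nonnegative element real. *)
have kR : k = real_complex R (complex.Re k).
  by move: k_ge0; rewrite lecE /= => /andP[/eqP kI _]; case: k kI {kE} => x y /= ->.
exists (complex.Re k); split; first by move: k_ge0; rewrite lecE => /andP[].
by rewrite wedgeE wedge_seq_igg volE scale_cformE -kR -kE.
Qed.
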